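(* Let $K=\mathbb{Q}(\sqrt{-d})$ where $-d$ is the discriminant of $K$, $-d\equiv 1\pmod 3$, and $3\mid h(K)$, and let $d_1$ be the square-free part of $d$. Then there are infinitely many positive fundamental discriminants $D\equiv 1\pmod{12d_1}$ for which the equation $x^3+y^3=z^3$ has a solution with $x,y,z$ in the quartic field $L=\mathbb{Q}(\sqrt{-d},\sqrt{D})$ and $xyz\neq 0$.
   Context: $h(K)$ denotes the class number of $K$. A nontrivial solution of the cubic Fermat equation means a solution with $xyz\neq 0$. *)

(* Defs.v *)
From HB Require Import structures.
From mathcomp Require Import all_boot all_order all_algebra all_field.

Set Implicit Arguments.
Unset Strict Implicit.
Unset Printing Implicit Defensive.

Import Order.TTheory GRing.Theory Num.Theory.
Local Open Scope ring_scope.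

(* Number fields are finite extensions K : fieldExtType rat. *)

Definition is_alg_int (K : fieldExtType rat) (x : K) : Prop :=
  integralOver (intr : int -> K) x.

(* The trace over the rationals of multiplication by x, in coordinates. *)
Definition field_trace (K : fieldExtType rat) (x : K) : rat :=
  \sum_(i < \dim {:K}) coord (vbasis {:K}) i (x * (vbasis {:K})`_i).

Definition integral_basis (K : fieldExtType rat) (e : (\dim {:K}).-tuple K)
    : Prop :=
  basis_of {:K}%VS e /\
  forall x : K, is_alg_int x <->
    exists c : 'I_(\dim {:K}) -> int, x = \sum_(i < \dim {:K}) e`_i *~ c i.

(* An integral basis always exists and all of them give the same value, so
   this relation is functional. *)
Definition discriminant (K : fieldExtType rat) (D : int) : Prop :=
  exists e : (\dim {:K}).-tuple K,
    integral_basis e /\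
    \det (\matrix_(i < \dim {:K}, j < \dim {:K}) field_trace (e`_i * e`_j))
      = D%:~R.

Definition nonzero_ideal (K : fieldExtType rat) (I : K -> Prop) : Prop :=
  [/\ forall x, I x -> is_alg_int x,
      exists2 x, I x & x != 0,
      forall x y, I x -> I y -> I (x + y)
    & forall a x, is_alg_int a -> I x -> I (a * x)].

(* (a) I = (b) J for some nonzero algebraic integers a, b of K. *)
Definition ideal_equiv (K : fieldExtType rat) (I J : K -> Prop) : Prop :=
  exists a b : K,
    [/\ is_alg_int a, is_alg_int b, a != 0, b != 0
      & forall x : K,
          (exists2 y, I y & x = a * y) <-> (exists2 z, J z & x = b * z)].

(* h(K) = h: the family c is a system of representatives of the ideal
   classes.  The relation is functional in h. *)
Definition class_number (K : fieldExtType rat) (h : nat) : Prop :=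
  exists c : 'I_h -> K -> Prop,
    [/\ forall i, nonzero_ideal (c i),
        forall i j, ideal_equiv (c i) (c j) -> i = j
      & forall I, nonzero_ideal I -> exists i, ideal_equiv I (c i)].

(* K = Q(sqrt m), up to isomorphism. *)
Definition is_Qsqrt (m : int) (K : fieldExtType rat) : Prop :=
  exists2 s : K, s ^+ 2 = m%:~R & <<1; s>>%VS = {:K}%VS.

(* L = Q(sqrt m, sqrt n), up to isomorphism. *)
Definition is_Qsqrt2 (m n : int) (L : fieldExtType rat) : Prop :=
  exists s t : L,
    [/\ s ^+ 2 = m%:~R, t ^+ 2 = n%:~R & <<1 & [:: s; t]>>%VS = {:L}%VS].

(* In particular 0 is not squarefree. *)
Definition squarefree (n : nat) : Prop :=
  forall m : nat, (m ^ 2 %| n)%N -> m = 1%N.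

(* For n > 0, s is the squarefree integer with n = s * square. *)
Definition squarefree_part (n s : nat) : Prop :=
  squarefree s /\ exists m : nat, n = (s * m ^ 2)%N.

(* This includes D = 1, which is not the discriminant of a quadratic field. *)
Definition fundamental_discriminant (D : int) : Prop :=
  ((D = 1 %[mod 4])%Z /\ squarefree `|D|%N) \/
  (exists m : int,
     [/\ D = 4 * m, (m = 2 %[mod 4])%Z \/ (m = 3 %[mod 4])%Z
       & squarefree `|m|%N]).

(* Main.v *)
(* Write a solution over Q(sqrt (- d1 D)) as x, y = - u ± g with g ^ 2 a rational
   number: the equation becomes - 6 u g ^ 2 = z ^ 3 + 2 u ^ 3.  Putting
   u = 2 d1 w, it is solvable as soon as 3 D = w (z ^ 3 + 16 d1 ^ 3 w ^ 3) up to a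
   square.  Since d1 = 2 mod 3, the congruences w = 3 + 8 d1 and z = 1 modulo
   36 d1 force D = 1 mod 12 d1, with no condition left at the primes dividing
   6 d1.  It remains to make D squarefree, which is a sieve: in a box w < T ^ 4,
   z < T ^ 6, the values divisible by p ^ 2 are counted directly for p < C T ^ 5,
   while for larger p the ratio z / w is a root of x ^ 3 = - c modulo p, and two
   coprime pairs with the same ratio modulo p ^ 2 coincide, so each p excludes at
   most three pairs. *)
Require Import Defs.
From HB Require Import structures.
From mathcomp Require Import all_boot all_order all_algebra all_field.
From mathcomp Require Import zify ring lra.

Set Implicit Arguments.
Unset Strict Implicit.
Unset Printing Implicit Defensive.

Import Order.TTheory GRing.Theory Num.Theory.
Local Open Scope ring_scope.

(** * Counting along arithmetic progressions *)

Lemma leq_card_bigcup (I T : finType) (P : pred I) (F : I -> {set T}) :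
  (#|\bigcup_(i | P i) F i| <= \sum_(i | P i) #|F i|)%N.
Proof.
elim/big_rec2: _ => [|i n A _ leAn]; first by rewrite cards0.
by rewrite (leq_trans (leq_card_setU _ _)) ?leq_add2l.
Qed.

(* A block of [q] consecutive indices meets [S] in at most [#|R|] points. *)
Lemma card_le_blocks (n q : nat) (T : finType) (R : {set T}) (f : nat -> T)
    (S : pred nat) :
  (0 < q)%N -> (forall i, S i -> f i \in R) ->
  (forall i j, S i -> S j -> f i = f j -> i = j %[mod q]) ->
  (#|[set i : 'I_n | S i]| <= (n %/ q).+1 * #|R|)%N.
Proof.
move=> q0 SR Sinj.
(* An index is recovered from its block and its label; the successor allows for an incomplete last
   block. *)
pose g (i : 'I_n) : 'I_(n %/ q).+1 * T := (inord (i %/ q), f i).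
have lt_q (i : 'I_n) : (i %/ q < (n %/ q).+1)%N.
  by rewrite ltnS leq_div2r // ltnW.
have ginj : {in [set i : 'I_n | S i] &, injective g}.
  move=> i j; rewrite !inE => Si Sj [] /(congr1 val) /=.
  rewrite !inordK // => eq_div /(Sinj _ _ Si Sj) eq_mod.
  by apply/val_inj; rewrite /= (divn_eq i q) (divn_eq j q) eq_div eq_mod.
rewrite -(card_in_imset ginj) -[X in (X * _)%N]card_ord -cardsT -cardsX.
apply/subset_leq_card/subsetP => _ /imsetP [i + ->]; rewrite inE => Si.
by rewrite !inE /= SR.
Qed.

Lemma eqmod_progression (q M a i j : nat) : coprime q M ->
  a + M * i = a + M * j %[mod q] -> i = j %[mod q].
Proof.
move=> coqM /eqP; rewrite eqn_modDl => eqM; apply/eqP.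
wlog le_ji : i j eqM / (j <= i)%N.
  move=> IH; case/orP: (leq_total j i) => [|le_ij]; first exact: IH.
  by rewrite eq_sym; apply: IH => //; rewrite eq_sym.
move: eqM; rewrite eqn_mod_dvd ?leq_mul2l ?le_ji ?orbT // -mulnBr Gauss_dvdr //.
by rewrite eqn_mod_dvd.
Qed.

Lemma card_dvd_progression (n q M a : nat) : (0 < q)%N -> coprime q M ->
  (#|[set i : 'I_n | q %| a + M * i]| <= (n %/ q).+1)%N.
Proof.
move=> q0 coqM; rewrite -[X in (_ <= X)%N]muln1 -[X in (_ * X)%N]card_unit -cardsT.
apply: (@card_le_blocks _ _ _ _ (fun=> tt) (fun i => q %| a + M * i)%N) => //.
move=> i j qi qj _; apply: (@eqmod_progression q M a) => //.
by rewrite (eqP qi) (eqP qj).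
Qed.

(** * Cubes modulo [p] and modulo [p ^ 2] *)

Lemma eqmod_natFp (p m n : nat) : prime p ->
  m%:R = n%:R :> 'F_p -> m = n %[mod p].
Proof. by move=> pp /(congr1 val) /=; rewrite !val_Fp_nat. Qed.

Lemma natFp_eq0 (p n : nat) : prime p -> (n%:R == 0 :> 'F_p) = (p %| n)%N.
Proof. by move=> pp; rewrite (dvdn_pcharf (pchar_Fp pp)). Qed.

Lemma card_cube_roots (p : nat) (e : 'F_p) :
  (#|[set x : 'F_p | (x ^+ 3 + e == 0)%R]| <= 3)%N.
Proof.
have size4 : size ('X^3 + e%:P) = 4%N.
  by rewrite size_polyDl size_polyXn // (leq_ltn_trans (size_polyC_leq1 _)).
rewrite -ltnS -size4 cardE; apply: max_poly_roots; last exact: enum_uniq.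
- by rewrite -size_poly_eq0 size4.
- by apply/allP => x; rewrite mem_enum inE rootE !hornerE.
Qed.

(** Uniqueness in Hensel's lemma: with [a = b + k] and [p] dividing [k], the cofactor of [k] in
    [a ^ 3 - b ^ 3] is [3 * b ^ 2] modulo [p], a unit, so [p ^ 2] divides [k] itself. *)
Lemma cube_lift (p a b : nat) : prime p -> (3 < p)%N -> ~~ (p %| b)%N ->
  a = b %[mod p] -> a ^ 3 = b ^ 3 %[mod p ^ 2] -> a = b %[mod p ^ 2].
Proof.
move=> pp p3; wlog le_ba : a b / (b <= a)%N => [IH pb eab ecub|].
  case/orP: (leq_total b a) => [le|le]; first exact: IH.
  by apply/esym/IH => //; rewrite /dvdn eab.
move=> pb /eqP; rewrite eqn_mod_dvd // => pk /eqP.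
rewrite eqn_mod_dvd ?leq_exp2r // => pcub; apply/eqP; rewrite eqn_mod_dvd //.
move: pk pcub; rewrite -(subnK le_ba); move: (a - b)%N => k; rewrite addnK.
have -> : ((k + b) ^ 3 - b ^ 3 = k * (3 * b ^ 2 + k * (3 * b + k)))%N.
  by rewrite (_ : (k + b) ^ 3 = k * (3 * b ^ 2 + k * (3 * b + k)) + b ^ 3)%N
             ?addnK //; ring.
move=> pk; rewrite Gauss_dvdl // coprimeXl // prime_coprime //.
rewrite (dvdn_addl _ (dvdn_mulr _ pk)) Euclid_dvdM // Euclid_dvdX // (negPf pb) /= orbF.
by rewrite gtnNdvd.
Qed.

(** * Bad pairs for a single prime *)

Lemma card_pairs_fibre (A B k : nat) (S : {set 'I_A * 'I_B}) :
  (forall i, #|[set j | (i, j) \in S]| <= k)%N -> (#|S| <= A * k)%N.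
Proof.
move=> fib; rewrite -sum1_card big_mkcond /=.
have -> : (\sum_x (if x \in S then 1 else 0) =
    \sum_(i < A) \sum_(j < B) if (i, j) \in S then 1 else 0)%N.
  by rewrite pair_bigA; apply: eq_bigr => -[].
rewrite -[X in (_ <= X * _)%N]card_ord -sum_nat_const leq_sum // => i _.
by rewrite -big_mkcond sum1dep_card.
Qed.

Lemma card_common_factor (A B M w0 z0 p : nat) : (0 < p)%N -> coprime p M ->
  (#|[set x : 'I_A * 'I_B | (p %| w0 + M * x.1) && (p %| z0 + M * x.2)]|
    <= (A %/ p).+1 * (B %/ p).+1)%N.
Proof.
move=> p0 copM.
rewrite (leq_trans _ (leq_mul (card_dvd_progression A w0 p0 copM)
                              (card_dvd_progression B z0 p0 copM))) //.
by rewrite -cardsX; apply/subset_leq_card/subsetP => x; rewrite !inE.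
Qed.

Lemma card_square_factor (A B M w0 q : nat) : (0 < q)%N -> coprime q M ->
  (#|[set x : 'I_A * 'I_B | q %| w0 + M * x.1]| <= (A %/ q).+1 * B)%N.
Proof.
move=> q0 coqM.
rewrite (leq_trans _ (leq_mul (card_dvd_progression A w0 q0 coqM) (leqnn _))) //.
rewrite -[X in (_ <= _ * X)%N]card_ord -cardsT -cardsX.
by apply/subset_leq_card/subsetP => x; rewrite !inE andbT.
Qed.

Lemma prime_notdvd_cube_form (p c w z : nat) : prime p -> ~~ (p %| c)%N ->
  ~~ (p %| w)%N -> (p ^ 2 %| z ^ 3 + c * w ^ 3)%N -> ~~ (p %| z)%N.
Proof.
move=> pp pc pw pf; apply: contra pw => pz.
have: (p %| z ^ 3 + c * w ^ 3)%N by apply: dvdn_trans pf; rewrite dvdn_exp.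
by rewrite dvdn_addr ?dvdn_exp // Euclid_dvdM // (negPf pc) Euclid_dvdX // andbT.
Qed.

(** For fixed [w], the residue of [z] modulo [p] is one of at most three cube roots of
    [- c * w ^ 3]. By [cube_lift] it determines [z] modulo [p ^ 2], hence the index within a block
    of length [p ^ 2]. *)
Lemma card_cube_form_small (A B M c w0 z0 p : nat) : prime p -> (3 < p)%N ->
  coprime p M -> ~~ (p %| c)%N ->
  (#|[set x : 'I_A * 'I_B | let w := w0 + M * x.1 in let z := z0 + M * x.2 in
       [&& coprime w z, ~~ (p %| w) & p ^ 2 %| z ^ 3 + c * w ^ 3]]|
    <= A * ((B %/ p ^ 2).+1 * 3))%N.
Proof.
move=> pp p3 copM pc; apply: card_pairs_fibre => i.
set w := (w0 + M * i)%N.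
pose S j := (~~ (p %| w) && (p ^ 2 %| (z0 + M * j) ^ 3 + c * w ^ 3))%N.
pose e : 'F_p := (c * w ^ 3)%:R.
have p2_gt0 : (0 < p ^ 2)%N by rewrite expn_gt0 prime_gt0.
have : (#|[set j : 'I_B | S j]| <=
    (B %/ p ^ 2).+1 * #|[set x : 'F_p | (x ^+ 3 + e == 0)%R]|)%N.
  apply: (@card_le_blocks _ _ _ _ (fun j => (z0 + M * j)%:R)) => //.
  - move=> j /andP [pw pf]; rewrite inE -natrX -natrD natFp_eq0 //.
    by apply: dvdn_trans pf; rewrite dvdn_exp.
  move=> j k /andP [pw pj] /andP [_ pk] /(eqmod_natFp pp) ejk.
  apply: (@eqmod_progression _ M z0); first by rewrite coprimeXl.
  apply: (cube_lift pp p3 _ ejk).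
    exact: prime_notdvd_cube_form pk.
  by apply/eqP; rewrite -(eqn_modDr (c * w ^ 3)) (eqP pj) (eqP pk).
move=> /leq_trans; have /leq_trans := leq_mul (leqnn (B %/ p ^ 2).+1) (card_cube_roots e).
move=> /(_ _ (leqnn _)) le3 /(_ _ le3); apply: leq_trans.
by apply/subset_leq_card/subsetP => j; rewrite !inE => /and3P [_ pw pf]; apply/andP.
Qed.

Lemma coprime_cross_inj (w z w' z' : nat) :
  coprime w z -> coprime w' z' -> (z * w' = z' * w)%N -> w = w'.
Proof.
move=> co co' e; apply/eqP; rewrite eqn_dvd; apply/andP; split.
  by rewrite -(Gauss_dvdr _ co) e dvdn_mull.
by rewrite -(Gauss_dvdr _ co') -e dvdn_mull.
Qed.

(* Pairs with the same ratio mod [p] have the same ratio mod [p ^ 2], hence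
   have the same ratio, as [p ^ 2] exceeds the cross products. *)
Lemma card_cube_form_large (A B M c w0 z0 p : nat) : prime p -> (3 < p)%N ->
  (0 < M)%N -> ~~ (p %| c)%N -> (0 < w0)%N ->
  (forall (i : 'I_A) (j : 'I_B), (w0 + M * i) * (z0 + M * j) < p ^ 2)%N ->
  (#|[set x : 'I_A * 'I_B | let w := w0 + M * x.1 in let z := z0 + M * x.2 in
       [&& coprime w z, ~~ (p %| w) & p ^ 2 %| z ^ 3 + c * w ^ 3]]|
    <= 3)%N.
Proof.
move=> pp p3 M0 pc w00 small; set S := [set x | _].
pose g (x : 'I_A * 'I_B) : 'F_p := (z0 + M * x.2)%:R / (w0 + M * x.1)%:R.
have ginj : {in S &, injective g}.
  move=> [i j] [i' j']; rewrite !inE /g /=.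
  have := small i j'; have := small i' j.
  have : (0 < w0 + M * i)%N by rewrite addn_gt0 w00.
  move Dw: (w0 + M * i)%N => w; move Dz: (z0 + M * j)%N => z.
  move Dw': (w0 + M * i')%N => w'; move Dz': (z0 + M * j')%N => z'.
  move=> wgt0 lt1 lt2 /and3P [co pw pf] /and3P [co' pw' pf'] eqg.
  have eqp : (z * w' = z' * w %[mod p])%N.
    apply: (eqmod_natFp pp); rewrite !natrM; apply/eqP.
    by rewrite -eqr_div ?natFp_eq0 //; apply/eqP.
  have npzw : ~~ (p %| z' * w)%N.
    rewrite Euclid_dvdM // negb_or pw andbT.
    exact: prime_notdvd_cube_form pf'.
  (* Adding [c * (w * w') ^ 3] turns both sides into multiples of values of the form, which [p ^ 2]
     divides. *)
  have eqc : ((z * w') ^ 3 = (z' * w) ^ 3 %[mod p ^ 2])%N.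
    apply/eqP; rewrite -(eqn_modDr (c * (w * w') ^ 3)).
    have -> : ((z * w') ^ 3 + c * (w * w') ^ 3 = (z ^ 3 + c * w ^ 3) * w' ^ 3)%N
      by ring.
    have -> : ((z' * w) ^ 3 + c * (w * w') ^ 3 = (z' ^ 3 + c * w' ^ 3) * w ^ 3)%N
      by ring.
    by rewrite (eqP (dvdn_mulr _ pf)) (eqP (dvdn_mulr _ pf')).
  have := cube_lift pp p3 npzw eqp eqc.
  rewrite !modn_small ?[(z * w')%N]mulnC ?[(z' * w)%N]mulnC // => eqx.
  have eqw : w = w'.
    by apply: (@coprime_cross_inj w z w' z') => //; rewrite mulnC eqx mulnC.
  have eqz : z = z'.
    by apply/eqP; rewrite -(eqn_pmul2l wgt0) -eqx eqw.
  congr (_, _); apply/val_inj/eqP => /=; rewrite -(eqn_pmul2l M0).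
    by rewrite -(eqn_add2l w0) Dw Dw' eqw.
  by rewrite -(eqn_add2l z0) Dz Dz' eqz.
rewrite -(card_in_imset ginj) (leq_trans _ (card_cube_roots (c%:R : 'F_p))) //.
apply/subset_leq_card/subsetP => _ /imsetP [[i j] + ->].
rewrite !inE /g /= => /and3P [_ pw pf].
have w_neq0 : (w0 + M * i)%:R != 0 :> 'F_p by rewrite natFp_eq0.
(* Clearing the cubed denominator leaves the value of the form. *)
rewrite -(mulIr_eq0 _ (mulIf (expf_neq0 3 w_neq0))) mulrDl expr_div_n divfK ?expf_neq0 //.
rewrite -!natrX -natrM -natrD natFp_eq0 //.
by apply: dvdn_trans pf; rewrite dvdn_exp.
Qed.

(** * Summing the bounds over the primes *)

(** Telescoping: for [p = 2 k + 1], [1 / p ^ 2] is below [1 / (4 k (k + 1))], a quarter of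
    [1 / k - 1 / (k + 1)], and the sum starts at [k = 2]. *)
Lemma sum_odd_inv_sqr (R : realFieldType) (X : nat) :
  \sum_(p < X | odd p && (4 < p)%N) (p%:R ^+ 2)^-1 <= 8^-1 :> R.
Proof.
have [ltX4 | ] := ltnP X 4.
  rewrite big1 ?invr_ge0 // => p /andP [_ p4].
  by have := ltn_trans (ltn_ord p) (ltn_trans ltX4 p4); rewrite ltnn.
(* The induction has to keep the tail of the telescoping sum; at [X = 4] both sides vanish. *)
move=> leX4; suff /le_trans : \sum_(p < X | odd p && (4 < p)%N) (p%:R ^+ 2)^-1
    <= 8^-1 - (4 * (X./2)%:R)^-1 :> R.
  by apply; rewrite gerBl invr_ge0 mulr_ge0.
rewrite -(subnK leX4); elim: (X - 4)%N => {X leX4} [|n IHn].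
  have -> : 4 * ((0 + 4)./2)%:R = 8 :> R by rewrite -natrM.
  rewrite subrr add0n big1 // => p /andP [_ p4].
  by have := ltn_trans (ltn_ord p) p4; rewrite ltnn.
rewrite addSn big_mkcond big_ord_recr -big_mkcond /=.
case: ifP => [/andP [odd_n _] | odd_n].
- rewrite (eqP (_ : uphalf (n + 4) == (n + 4)./2.+1)%N); last by rewrite uphalf_half odd_n.
  have : (n + 4 = ((n + 4)./2).*2.+1)%N by rewrite -[LHS]odd_double_half odd_n.
  have : (1 < (n + 4)./2)%N by rewrite addnC.
  move: IHn; move: (n + 4)./2 => k IHn k1 def_n.
  apply: (le_trans (lerD IHn (lexx _))); rewrite def_n.
  have k0 : 0 < k%:R :> R by rewrite ltr0n ltnW.
  have -> : (k.*2.+1)%:R = 2 * k%:R + 1 :> R by rewrite -natr1 -muln2 natrM mulrC.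
  rewrite -addrA lerD2l -[k.+1%:R]natr1.
  have -> : - (4 * (k%:R + 1))^-1 = - (4 * k%:R)^-1 + (4 * k%:R * (k%:R + 1))^-1 :> R.
    by field; rewrite !gt_eqF ?addr_gt0.
  rewrite lerD2l lef_pV2 ?posrE ?exprn_gt0 ?mulr_gt0 ?addr_gt0 ?mulr_gt0 //.
  by lra.
- have even_n : odd (n + 4) = false.
    apply: contraFF odd_n => odd_n; rewrite odd_n /=.
    by case: (n) odd_n => // m _; rewrite addSn !ltnS leq_addl.
  rewrite addr0 uphalf_half even_n add0n.
  exact: IHn.
Qed.

(** Turns a bound [a / p ^ 2 + b] for each [p] into a total: [a / 8] from the densities, [b * X]
    from the rounding errors. *)
Lemma sum_leq_inv_sqr (P : pred nat) (X : nat) (F : nat -> nat) (a b : nat) :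
  (forall p, P p -> odd p && (4 < p)%N) ->
  (forall p, P p -> (p < X)%N -> F p * p ^ 2 <= a + b * p ^ 2)%N ->
  (8 * (\sum_(p < X | P p) F p) <= a + 8 * (b * X))%N.
Proof.
suff fieldP (R : realFieldType) : (forall p, P p -> odd p && (4 < p)%N) ->
    (forall p, P p -> (p < X)%N -> F p * p ^ 2 <= a + b * p ^ 2)%N ->
    (8 * (\sum_(p < X | P p) F p) <= a + 8 * (b * X))%N.
  exact: (fieldP rat).
move=> Podd leF; rewrite -(ler_nat R) natrD !natrM.
suff : (\sum_(p < X | P p) F p)%:R <= a%:R * 8^-1 + b%:R * X%:R :> R by lra.
rewrite natr_sum.
have leF' (p : 'I_X) : P p -> (F p)%:R <= a%:R * (p%:R ^+ 2)^-1 + b%:R :> R.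
  move=> Pp; have p0 : 0 < p%:R ^+ 2 :> R.
    by rewrite exprn_gt0 // ltr0n; case/andP: (Podd _ Pp) => _ /(leq_trans _) ->.
  have -> : a%:R * (p%:R ^+ 2)^-1 + b%:R = (a + b * p ^ 2)%:R / p%:R ^+ 2 :> R.
    by rewrite natrD natrM natrX mulrDl mulfK ?gt_eqF.
  by rewrite ler_pdivlMr // -natrX -natrM ler_nat leF.
apply: le_trans (ler_sum _ leF') _.
rewrite big_split /= -mulr_sumr lerD //.
  rewrite ler_wpM2l //; apply: le_trans (sum_odd_inv_sqr R X).
  rewrite big_mkcond [leRHS]big_mkcond ler_sum // => p _.
  case: ifP => [/Podd -> //|_]; case: ifP => // _.
  by rewrite invr_ge0 exprn_ge0.
rewrite sumr_const -[leLHS]mulr_natr ler_wpM2l // ler_nat.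
by rewrite (leq_trans (max_card _)) ?card_ord.
Qed.

(** * The sieve *)

(** Serves for the product of two rounded-up counts, multiplied by [p ^ 2]. The mixed terms are at
    most [2 * (b * p)]. *)
Lemma leq_mul_addn (a b p s t : nat) :
  (a <= b)%N -> (2 * (b * p) <= s + t * p ^ 2)%N ->
  ((a + p) * (b + p) <= a * b + s + (t + 1) * p ^ 2)%N.
Proof.
move=> leab; have := leq_mul leab (leqnn p).
by rewrite mulnDl !mulnDr mulnDl mul1n -mulnn [(p * b)%N]mulnC; lia.
Qed.

Lemma ltn_progression (a m i n E : nat) :
  (0 < m)%N -> (a + m <= E)%N -> (i < n)%N -> (a + m * i < E * n)%N.
Proof.
move=> m0 leE lt_in; apply: (@leq_trans ((a + m) * n)%N); last by rewrite leq_mul2r leE orbT.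
rewrite mulnDl -addnS leq_add ?leq_pmulr ?ltn_pmul2l //.
by apply: leq_ltn_trans lt_in.
Qed.

(* The union bound leaves a positive proportion, at least 1 - 5/8, of the
   pairs [i < T ^ 4], [j < T ^ 6]: for each prime the three kinds of bad pairs
   have density at most 5 / p ^ 2 in total, and the error terms are
   O(T ^ 9). *)
Lemma squarefree_cube_form (M c w0 z0 : nat) :
  (0 < M)%N -> (0 < c)%N -> (0 < w0)%N -> coprime w0 M ->
  (forall p, prime p -> ~~ (p %| M)%N -> (4 < p)%N && ~~ (p %| c)%N) ->
  exists i j, forall p, prime p -> ~~ (p %| M)%N ->
    ~~ (p ^ 2 %| (w0 + M * i) * ((z0 + M * j) ^ 3 + c * (w0 + M * i) ^ 3))%N.
Proof.
move=> M0 c0 w00 cow large.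
(* [E] gives [w < E T ^ 4] and [z < E T ^ 6], whence values of the form are at most [C T ^ 18]. The
   factor 27 below lets the box size [27 C T ^ 9] beat the error terms. *)
pose E := (w0 + z0 + M)%N; pose C := (E ^ 3 * (1 + c))%N.
have [T defT] : exists T, T = (27 * C)%N by exists (27 * C)%N.
pose A := (T ^ 4)%N; pose B := (T ^ 6)%N.
pose w i := (w0 + M * i)%N; pose z j := (z0 + M * j)%N.
pose f i j := (z j ^ 3 + c * w i ^ 3)%N.
have E0 : (0 < E)%N by rewrite addn_gt0 M0 orbT.
have leEC : (E <= C)%N by rewrite (leq_trans (leq_pexp2l E0 (isT : 1 <= 3)%N)) ?leq_pmulr.
have C0 : (0 < C)%N by apply: leq_trans leEC.
have T0 : (0 < T)%N by rewrite defT muln_gt0 C0.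
have w_gt0 i : (0 < w i)%N by rewrite addn_gt0 w00.
have w_lt (i : 'I_A) : (w i < E * T ^ 4)%N.
  by apply: ltn_progression => //; rewrite /E addnAC leq_addr.
have z_lt (j : 'I_B) : (z j < E * T ^ 6)%N.
  by apply: ltn_progression => //; rewrite /E -addnA leq_addl.
have co_wM i : coprime (w i) M.
  by rewrite -coprime_modl /w addnC mulnC modnMDl coprime_modl.
pose good p := prime p && ~~ (p %| M)%N.
have goodP p : good p -> [/\ prime p, coprime p M, (4 < p)%N & ~~ (p %| c)%N].
  by case/andP=> pp pM; have /andP [] := large p pp pM; split; rewrite ?prime_coprime.
have good_odd p : good p -> odd p && (4 < p)%N.
  by case/goodP=> pp _ p4 _; case: (even_prime pp) p4 => [->|->].
pose bad (x : 'I_A * 'I_B) p := good p && (p ^ 2 %| w x.1 * f x.1 x.2)%N.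
have f_gt0 i j : (0 < f i j)%N by rewrite addn_gt0 muln_gt0 c0 !expn_gt0 w_gt0 orbT.
case: (boolP [forall x : 'I_A * 'I_B, has (bad x) (primes (w x.1 * f x.1 x.2))]); last first.
  case/forallPn => -[i j] /= /hasPn nbad; exists (val i), (val j) => p pp pM.
  apply/negP => p2.
  have /nbad : p \in primes (w i * f i j)%N.
    by rewrite mem_primes pp muln_gt0 w_gt0 f_gt0 (dvdn_trans _ p2) ?dvdn_exp.
  by rewrite /bad /good pp pM p2.
move=> /forallP all_bad; exfalso.
pose bad_gcd p := [set x : 'I_A * 'I_B | (p %| w x.1) && (p %| z x.2)]%N.
pose bad_w p := [set x : 'I_A * 'I_B | p ^ 2 %| w x.1]%N.
pose bad_f p := [set x : 'I_A * 'I_B |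
  [&& coprime (w x.1) (z x.2), ~~ (p %| w x.1) & p ^ 2 %| f x.1 x.2]]%N.
(* Ranges of the primes: a common factor is at most [w]; [p ^ 2] dividing [w] gives [p < Xb];
   [p ^ 2] dividing the form gives [p <= C T ^ 9]. From [Xc] on, [p ^ 2] exceeds every product
   [w z]. *)
pose Xa := (C * T ^ 4)%N; pose Xb := (C * T ^ 2)%N; pose Xc := (C * T ^ 5)%N.
pose Xd := (C * T ^ 9).+1.
have f_le (i : 'I_A) (j : 'I_B) : (f i j <= (C * T ^ 9) ^ 2)%N.
  apply: (@leq_trans ((E * T ^ 6) ^ 3 * (1 + c))%N).
    rewrite mulnDr muln1 [X in (_ <= _ + X)%N]mulnC.
    rewrite leq_add ?leq_exp2r ?(ltnW (z_lt j)) // leq_mul2l leq_exp2r //.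
    by rewrite (leq_trans (ltnW (w_lt i))) ?orbT // leq_mul2l leq_pexp2l ?orbT.
  have -> : ((E * T ^ 6) ^ 3 * (1 + c) = C * T ^ 18)%N by rewrite expnMn -expnM mulnAC.
  have -> : ((C * T ^ 9) ^ 2 = C * (C * T ^ 18))%N.
    by rewrite expnMn -expnM mulnA mulnn.
  by rewrite leq_pmull.
have cover : [set: 'I_A * 'I_B] \subset
    (\bigcup_(p < Xa | good p) bad_gcd p :|: \bigcup_(p < Xb | good p) bad_w p) :|:
    (\bigcup_(p < Xc | good p) bad_f p :|:
     \bigcup_(p < Xd | good p && (Xc <= p)%N) bad_f p).
  apply/subsetP => -[i j] _; have /hasP [p _ /andP [/goodP [pp copM p4 pc] p2]] := all_bad (i, j).
  rewrite /= in p2.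
  have gp : good p by rewrite /good pp -prime_coprime.
  case: (boolP (coprime (w i) (z j))) => [co | nco]; last first.
    (* A prime [r] of the gcd replaces [p]; it is good because [w i] is coprime to [M]. *)
    pose r := pdiv (gcdn (w i) (z j)).
    have rp : prime r.
      by rewrite pdiv_prime // ltn_neqAle eq_sym nco gcdn_gt0 w_gt0.
    have rw : (r %| w i)%N by rewrite (dvdn_trans (pdiv_dvd _)) ?dvdn_gcdl.
    have rz : (r %| z j)%N by rewrite (dvdn_trans (pdiv_dvd _)) ?dvdn_gcdr.
    have rX : (r < Xa)%N.
      rewrite (leq_ltn_trans (dvdn_leq (w_gt0 i) rw)) // (leq_trans (w_lt i)) //.
      by rewrite leq_mul2r leEC orbT.
    rewrite !inE; apply/orP; left; apply/orP; left; apply/bigcupP.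
    exists (Ordinal rX); last by rewrite inE rw rz.
    rewrite /good rp /=; apply/negP => rM.
    by have := dvdn_gcd r (w i) M; rewrite (eqP (co_wM i)) rw rM dvdn1; case: (r) rp => [|[]].
  case: (boolP (p %| w i)%N) => pw.
    have pz : ~~ (p %| z j)%N.
      apply/negP => pz; have := dvdn_gcd p (w i) (z j).
      by rewrite (eqP co) pw pz dvdn1; case: (p) p4 => [|[]].
    have p2w : (p ^ 2 %| w i)%N.
      move: p2; rewrite Gauss_dvdl // coprimeXl // prime_coprime //.
      by rewrite /f dvdn_addl ?Euclid_dvdX ?negb_and ?pz // dvdn_mull ?dvdn_exp.
    have pX : (p < Xb)%N.
      rewrite -ltn_sqr (leq_ltn_trans (dvdn_leq (w_gt0 i) p2w)) // (leq_trans (w_lt i)) //.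
      by rewrite /Xb expnMn -expnM leq_mul2r (leq_trans leEC) ?orbT ?leq_pmulr.
    rewrite !inE; apply/orP; left; apply/orP; right; apply/bigcupP.
    by exists (Ordinal pX); rewrite ?inE.
  have p2f : (p ^ 2 %| f i j)%N.
    by move: p2; rewrite Gauss_dvdr // coprimeXl // prime_coprime.
  have in_bad : (i, j) \in bad_f p by rewrite inE /= co pw p2f.
  rewrite !inE; apply/orP; right; apply/orP; case: (ltnP p Xc) => pX.
    by left; apply/bigcupP; exists (Ordinal pX).
  have pX' : (p < Xd)%N.
    by rewrite ltnS -leq_sqr (leq_trans (dvdn_leq (f_gt0 i j) p2f)).
  by right; apply/bigcupP; exists (Ordinal pX') => //=; rewrite gp.
have := subset_leq_card cover; rewrite cardsT card_prod !card_ord.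
move=> /leq_trans /(_ (leq_trans (leq_card_setU _ _)
  (leq_add (leq_card_setU _ _) (leq_card_setU _ _)))).
move=> /leq_trans /(_ (leq_add
  (leq_add (leq_card_bigcup _ _) (leq_card_bigcup _ _))
  (leq_add (leq_card_bigcup _ _) (leq_card_bigcup _ _)))).
have divS n p : ((n %/ p).+1 * p <= n + p)%N.
  by rewrite mulSn addnC leq_add2r leq_trunc_div.
have leAB : (A <= B)%N by rewrite leq_pexp2l.
have sum_gcd : (8 * (\sum_(p < Xa | good p) #|bad_gcd p|)
    <= A * B + T ^ 7 + 8 * ((T ^ 5 + 1) * Xa))%N.
  apply: (sum_leq_inv_sqr (F := fun p => #|bad_gcd p|) good_odd).
  move=> p /goodP [pp copM _ _] _.
  have /= le_card := card_common_factor A B w0 z0 (prime_gt0 pp) copM.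
  rewrite (leq_trans (leq_mul le_card (leqnn _))) //.
  rewrite -mulnn mulnACA (leq_trans (leq_mul (divS A p) (divS B p))) //.
  apply: leq_mul_addn leAB _; rewrite /B.
  (* By [2 T p <= T ^ 2 + p ^ 2], the mixed term costs [T ^ 7] in all and [T ^ 5] for each prime. *)
  have -> : (2 * (T ^ 6 * p) = T ^ 5 * (2 * (T * p)))%N by ring.
  have -> : (T ^ 7 + T ^ 5 * p ^ 2 = T ^ 5 * (T ^ 2 + p ^ 2))%N by ring.
  by rewrite leq_mul2l nat_Cauchy orbT.
have sum_w : (8 * (\sum_(p < Xb | good p) #|bad_w p|) <= A * B + 8 * (B * Xb))%N.
  apply: (sum_leq_inv_sqr (F := fun p => #|bad_w p|) good_odd).
  move=> p /goodP [pp copM _ _] _.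
  have q0 : (0 < p ^ 2)%N by rewrite expn_gt0 prime_gt0.
  have /= le_card := card_square_factor A B w0 q0 (coprimeXl 2 copM).
  rewrite (leq_trans (leq_mul le_card (leqnn _))) // mulnAC -[(B * p ^ 2)%N]mulnC.
  by rewrite -mulnDl leq_mul2r divS orbT.
have sum_f : (8 * (\sum_(p < Xc | good p) #|bad_f p|)
    <= 3 * (A * B) + 8 * (3 * A * Xc))%N.
  apply: (sum_leq_inv_sqr (F := fun p => #|bad_f p|) good_odd).
  move=> p /goodP [pp copM p4 pc] _.
  have /= le_card := card_cube_form_small A B w0 z0 pp (ltnW p4) copM pc.
  rewrite (leq_trans (leq_mul le_card (leqnn _))) //.
  have -> q r : (A * (q * 3) * r = 3 * A * (q * r))%N by ring.
  have -> r : (3 * (A * B) + 3 * A * r = 3 * A * (B + r))%N by ring.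
  by rewrite leq_mul2l divS orbT.
have sum_f_large : (\sum_(p < Xd | good p && (Xc <= p)) #|bad_f p| <= 3 * Xd)%N.
  apply: (@leq_trans (\sum_(p < Xd) 3)); last by rewrite sum_nat_const card_ord mulnC.
  rewrite [leqRHS](bigID (fun p : 'I_Xd => good p && (Xc <= p)%N)) /=.
  rewrite (leq_trans _ (leq_addr _ _)) // leq_sum // => p /andP [/goodP [pp _ p4 pc] leXp].
  apply: card_cube_form_large => //; first exact: ltnW.
  move=> i j; have := ltn_mul (w_lt i) (z_lt j); rewrite -/(w i) -/(z j).
  move=> /leq_trans; apply; apply: (@leq_trans (Xc ^ 2)%N); last by rewrite leq_sqr.
  by rewrite mulnACA -expnD mulnn /Xc expnMn -expnM leq_mul2r leq_sqr leEC orbT.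
move: sum_gcd sum_w sum_f sum_f_large.
set S1 := (\sum_(p < Xa | _) _)%N; set S2 := (\sum_(p < Xb | _) _)%N.
set S3 := (\sum_(p < Xc | _) _)%N; set S4 := (\sum_(p < Xd | _) _)%N.
have le_pow m n : (m <= n)%N -> (T ^ m <= T ^ n)%N by move=> ?; rewrite leq_pexp2l.
have T7 : (T ^ 7 <= C * T ^ 9)%N by rewrite (leq_trans (le_pow 7 9 isT)) ?leq_pmull.
have T4 : (C * T ^ 4 <= C * T ^ 9)%N by rewrite leq_mul2l le_pow ?orbT.
have T8 : (C * T ^ 8 <= C * T ^ 9)%N by rewrite leq_mul2l le_pow ?orbT.
have AB_E : (A * B = 27 * (C * T ^ 9))%N by rewrite -expnD (expnS _ 9) {1}defT mulnA.
have -> : ((T ^ 5 + 1) * Xa = C * T ^ 9 + C * T ^ 4)%N by rewrite /Xa; ring.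
have -> : (B * Xb = C * T ^ 8)%N by rewrite /Xb /B; ring.
have -> : (3 * A * Xc = 3 * (C * T ^ 9))%N by rewrite /Xc /A; ring.
(* With [Y = C T ^ 9], eight times the union bound is at most [5 A B + 73 Y + 24], whereas
   [8 A B = 5 A B + 81 Y]; so [3 < Y] is a contradiction. *)
have : (3 < C * T ^ 9)%N.
  by rewrite (leq_trans _ (leq_pmull _ C0)) // (leq_trans _ (le_pow 1 9 isT)) // expn1 defT; move: C0; clear; lia.
rewrite AB_E /Xd; move: T7 T4 T8; clearbody S1 S2 S3 S4; clear; lia.
Qed.

(** * Squarefree integers, the quartic field and the point over it *)

Lemma squarefree_prime_sqr (n : nat) :
  (0 < n)%N -> (forall p, prime p -> ~~ (p ^ 2 %| n)%N) -> squarefree n.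
Proof.
move=> n0 sqf [|[|m]] mn //.
  by move: mn n0; rewrite expnE dvd0n => /eqP ->.
have pp : prime (pdiv m.+2) by rewrite pdiv_prime.
by case/negP: (sqf _ pp); apply: dvdn_trans mn; rewrite dvdn_exp2r ?pdiv_dvd.
Qed.

(** A prime factor of [n] has valuation one in [n], so its valuation in [n * denq r ^ 2] is odd, but
    in [numq r ^ 2] even. *)
Lemma squarefree_not_ratsqr (n : nat) (r : rat) :
  squarefree n -> (1 < n)%N -> r ^+ 2 != n%:R.
Proof.
move=> sqf n1; apply/eqP => r2.
have b0 : (0 < `|denq r|)%N by rewrite absz_gt0 denq_neq0.
have e : (`|numq r| ^ 2 = n * `|denq r| ^ 2)%N.
  have : (numq r) ^+ 2 = n%:Z * (denq r) ^+ 2.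
    apply/eqP; rewrite -(eqr_int rat) rmorphXn rmorphM rmorphXn /= numqE exprMn r2.
    by rewrite pmulrn.
  by move/(congr1 absz); rewrite abszM !abszX.
have pp : prime (pdiv n) by rewrite pdiv_prime.
have p1 : logn (pdiv n) n = 1%N.
  apply/eqP; rewrite eqn_leq logn_gt0 mem_primes pp pdiv_dvd (ltnW n1) /= andbT.
  rewrite leqNgt; apply/negP => le2.
  have /sqf p_eq1 : (pdiv n ^ 2 %| n)%N by rewrite pfactor_dvdn // (ltnW n1).
  by rewrite p_eq1 in pp.
move: (congr1 (logn (pdiv n)) e); rewrite lognM ?(ltnW n1) ?expn_gt0 ?b0 //.
by rewrite !lognX p1 => /(congr1 odd); rewrite oddD !oddM.
Qed.

Lemma adjoin_degree_sqrt (L : fieldExtType rat) (K : {subfield L}) (x : L) :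
  x ^+ 2 \in K -> x \notin K -> adjoin_degree K x = 2%N.
Proof.
move=> x2K xK; have deg_n1 : adjoin_degree K x != 1%N by rewrite adjoin_deg_eq1.
have : (adjoin_degree K x <= 2)%N.
  rewrite -ltnS -size_minPoly -(size_XnsubC (x ^+ 2) (isT : 0 < 2)%N).
  rewrite dvdp_leq -?size_poly_eq0 ?size_XnsubC //.
  apply: minPoly_dvdp; last by rewrite rootE !hornerE subrr.
  by rewrite rpredB ?rpredX ?polyOverX ?polyOverC.
by move: deg_n1; rewrite /adjoin_degree; case: (_.-1) => [|[|]].
Qed.

Lemma natL_neq0 (L : fieldExtType rat) (n : nat) : (0 < n)%N -> n%:R != 0 :> L.
Proof. by move=> n0; rewrite -(rmorph_nat (in_alg L)) fmorph_eq0 pnatr_eq0 -lt0n. Qed.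

Lemma sqrt_neg_notin_Q (L : fieldExtType rat) (s : L) (d : nat) :
  (0 < d)%N -> s ^+ 2 = - d%:R -> s \notin 1%VS.
Proof.
move=> d0 s2; apply/negP => /vlineP [k def_s].
have /eqP : in_alg L (k ^+ 2 + d%:R) = 0.
  by rewrite rmorphD rmorphXn rmorph_nat /= -def_s s2 addNr.
rewrite fmorph_eq0 gt_eqF //.
by rewrite ltr_wpDl ?sqr_ge0 // ltr0n.
Qed.

(** Squaring [t = a + b s] gives [D - a ^ 2 + d b ^ 2 = 2 a b s], so [a b = 0] as [s] is irrational.
    Then [a = 0] contradicts positivity and [b = 0] makes [D] a rational square. *)
Lemma sqrt_notin_imquad (L : fieldExtType rat) (s t : L) (d D : nat) :
  (0 < d)%N -> squarefree D -> (1 < D)%N ->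
  s ^+ 2 = - d%:R -> t ^+ 2 = D%:R -> t \notin <<1; s>>%VS.
Proof.
move=> d0 sqfD D1 s2 t2; have s_notin := sqrt_neg_notin_Q d0 s2.
have deg_s : adjoin_degree 1 s = 2%N.
  by apply: adjoin_degree_sqrt; rewrite // s2 rpredN rpred_nat.
apply/negP => /Fadjoin_poly_eq; set p := Fadjoin_poly _ _ _ => def_t.
have /polyOverP pQ : p \is a polyOver 1%VS by apply: Fadjoin_polyOver.
have /vlineP [a def_a] := pQ 0; have /vlineP [b def_b] := pQ 1%N.
have {}def_t : t = a%:A + b%:A * s.
  rewrite -def_t (horner_coef_wide _ (n := 2)); last first.
    by rewrite -deg_s size_Fadjoin_poly.
  by rewrite big_ord_recl big_ord1 /= expr0 mulr1 def_a def_b.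
have sqr_t : (D%:R - a ^+ 2 + d%:R * b ^+ 2)%:A = (2 * a * b)%:A * s.
  rewrite -!(in_algE L) !(rmorphD, rmorphB, rmorphM, rmorphXn, rmorph_nat) /=.
  move: t2; rewrite def_t -!(in_algE L) => <-.
  by rewrite sqrrD exprMn s2 -[d%:R]opprK -s2; ring.
have ab0 : 2 * a * b = 0.
  apply: contraNeq s_notin => ab_neq0.
  rewrite -[s](mulKf (_ : (2 * a * b)%:A != 0)) ?(fmorph_eq0 (in_alg L)) //.
  by rewrite -sqr_t rpredM ?rpredV ?rpredZ ?rpred1.
move: sqr_t; rewrite ab0 scale0r mul0r => /eqP.
rewrite (fmorph_eq0 (in_alg L)) => /eqP e.
move/eqP: ab0; rewrite !mulf_eq0 pnatr_eq0 /= => /orP [] /eqP z0.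
  move: e; rewrite z0 expr0n subr0 => /eqP; rewrite gt_eqF //.
  by rewrite ltr_pwDl ?ltr0n ?(ltnW D1) // mulr_ge0 ?sqr_ge0.
move: e; rewrite z0 expr0n mulr0 addr0 => /eqP; rewrite subr_eq0 eq_sym.
by rewrite (negPf (squarefree_not_ratsqr _ sqfD D1)).
Qed.

(** The field is generated by square roots in the algebraic numbers; both steps of the tower through
    [<<1; s>>] have degree two. *)
Lemma biquadratic_field (d D : nat) :
  (0 < d)%N -> squarefree D -> (1 < D)%N ->
  exists L : fieldExtType rat, exists s t : L,
    [/\ s ^+ 2 = - d%:R, t ^+ 2 = D%:R, <<1 & [:: s; t]>>%VS = {:L}%VS
      & \dim {:L} = 4%N].
Proof.
move=> d0 sqfD D1.
have [L [phi [[|s [|t [|]]] // [phis phit] full]]] :=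
  num_field_exists [:: sqrtC (- d%:R); sqrtC D%:R].
have s2 : s ^+ 2 = - d%:R.
  by apply: (fmorph_inj phi); rewrite rmorphXn /= phis sqrtCK rmorphN rmorph_nat.
have t2 : t ^+ 2 = D%:R.
  by apply: (fmorph_inj phi); rewrite rmorphXn /= phit sqrtCK rmorph_nat.
exists L, s, t; split=> //.
rewrite -full adjoin_cons adjoin_seq1 dim_Fadjoin.
rewrite adjoin_degree_sqrt ?t2 ?rpred_nat ?(sqrt_notin_imquad d0 sqfD D1 s2 t2) //.
rewrite dim_Fadjoin adjoin_degree_sqrt ?dimv1 ?s2 ?rpredN ?rpred_nat //.
exact: sqrt_neg_notin_Q s2.
Qed.

(* If [g ^ 2 = - d1 D], the cubes of [- u ^ 2 + g] and [- u ^ 2 - g] add up to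
   [u ^ 2 (6 d1 D - 2 u ^ 4) = (u z) ^ 3]; here [g = s t / m], and everything is
   scaled by [m]. *)
Lemma fermat_cubic_point (L : fieldExtType rat) (s t : L) (d d1 m D u z : nat) :
  (0 < m)%N -> (0 < u)%N -> (0 < z)%N -> (0 < d1)%N -> (0 < D)%N ->
  d = (d1 * m ^ 2)%N -> (6 * d1 * D = u * (z ^ 3 + 2 * u ^ 3))%N ->
  s ^+ 2 = - d%:R -> t ^+ 2 = D%:R ->
  exists x y v : L, x ^+ 3 + y ^+ 3 = v ^+ 3 /\ x * y * v != 0.
Proof.
move=> m0 u0 z0 d10 D0 def_d def_D s2 t2.
have g2 : (s * t) ^+ 2 = - (d1 * D * m ^ 2)%:R.
  by rewrite exprMn s2 t2 mulNr -natrM def_d mulnAC.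
pose a : L := (m * u ^ 2)%:R.
exists (- a + s * t), (- a - s * t), (m * u * z)%:R; split.
  have -> : (- a + s * t) ^+ 3 + (- a - s * t) ^+ 3
      = - (2 * a ^+ 3) - 6 * a * (s * t) ^+ 2 by ring.
  rewrite g2 /a mulrN opprK addrC; apply/eqP; rewrite subr_eq.
  have : (6 * (m * u ^ 2) * (d1 * D * m ^ 2) = (m * u * z) ^ 3 + 2 * (m * u ^ 2) ^ 3)%N.
    have -> : (6 * (m * u ^ 2) * (d1 * D * m ^ 2) = m ^ 3 * u ^ 2 * (6 * d1 * D))%N.
      by ring.
    by rewrite def_D; ring.
  by move=> /(congr1 (fun n => n%:R : L)) /eqP; rewrite natrD !(natrM _ (6 * _)) natrM
    [(2 * _)%:R]natrM natrX [((_ * _) ^ 3)%:R]natrX.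
(* The product of the two conjugates is a positive integer, hence nonzero in [L]. *)
have -> : (- a + s * t) * (- a - s * t) = a ^+ 2 - (s * t) ^+ 2 by ring.
rewrite g2 opprK /a -natrX -natrD -natrM natL_neq0 //.
by rewrite !(muln_gt0, addn_gt0, expn_gt0) m0 u0 z0.
Qed.

(** * Congruences and the choice of [D] *)

(** Modulo [36 d1] the value is [w + 16 d1 ^ 3 w ^ 4], that is,
    [3 + d1 (8 + 16 d1 ^ 2 (3 + 8 d1) ^ 4)]. The residue of [w] is chosen so that 36 divides the
    bracket; dividing by 3 leaves 1 modulo [12 d1]. *)
Lemma cube_form_congruence (d1 N i j : nat) : (d1 %% 3 = 2)%N ->
  exists Q, let w := (3 + 8 * d1 + 36 * d1 * N + 36 * d1 * i)%N in
    (w * ((1 + 36 * d1 * j) ^ 3 + 16 * d1 ^ 3 * w ^ 3) = 3 * (1 + 12 * d1 * Q))%N.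
Proof.
move=> d1_3 /=; set w := (3 + _ + _ + _)%N.
have [a ->] : exists a, ((1 + 36 * d1 * j) ^ 3 = 1 + 36 * d1 * a)%N.
  by exists (3 * j + 3 * (36 * d1) * j ^ 2 + (36 * d1) ^ 2 * j ^ 3)%N; ring.
have [b w4] : exists b, (w ^ 4 = (3 + 8 * d1) ^ 4 + 36 * d1 * b)%N.
  have -> : w = (3 + 8 * d1 + 36 * d1 * (N + i))%N by rewrite /w; ring.
  move: (3 + 8 * d1)%N (N + i)%N => r k.
  exists (4 * r ^ 3 * k + 6 * (36 * d1) * r ^ 2 * k ^ 2
    + 4 * (36 * d1) ^ 2 * r * k ^ 3 + (36 * d1) ^ 3 * k ^ 4)%N; ring.
have [q def_q] : exists q, (8 + 16 * d1 ^ 2 * (3 + 8 * d1) ^ 4 = 36 * q)%N.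
  (* With [d1 = 3 e + 2] all coefficients of this polynomial in [e] are
     divisible by 36. *)
  rewrite (divn_eq d1 3) d1_3; move: (d1 %/ 3)%N => e.
  exists
    (231682 + e * (1865648 + e * (6251076 + e * (11155584 + e * (11183616 + e * (5971968 + e * 1327104))))))%N; ring.
exists (q + N + i + a * w + 16 * d1 ^ 3 * b)%N.
have -> : (w * (1 + 36 * d1 * a + 16 * d1 ^ 3 * w ^ 3)
    = w + 36 * d1 * (a * w) + 16 * d1 ^ 3 * w ^ 4)%N by ring.
rewrite w4 {1}/w.
have -> : (3 + 8 * d1 + 36 * d1 * N + 36 * d1 * i + 36 * d1 * (a * w)
      + 16 * d1 ^ 3 * ((3 + 8 * d1) ^ 4 + 36 * d1 * b)
    = 3 + d1 * (8 + 16 * d1 ^ 2 * (3 + 8 * d1) ^ 4)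
      + 36 * d1 * (N + i + a * w + 16 * d1 ^ 3 * b))%N by ring.
by rewrite def_q; ring.
Qed.

Theorem theorem6p4 (d d1 h : nat) (K : fieldExtType rat)
  (d_gt0 : (0 < d)%N)
  (K_def : is_Qsqrt (- d%:Z) K)
  (K_disc : discriminant K (- d%:Z))
  (d_mod3 : (- d%:Z = 1 %[mod 3])%Z)
  (K_class : class_number K h)
  (h_div3 : (3 %| h)%N)
  (d1_def : squarefree_part d d1) :
  forall N : nat, exists D : nat,
    [/\ (N < D)%N,
        fundamental_discriminant D%:Z,
        (D = 1 %[mod 12 * d1])%N
      & exists L : fieldExtType rat,
          [/\ is_Qsqrt2 (- d%:Z) D%:Z L,
              \dim {:L} = 4%N
            & exists x y z : L,
                x ^+ 3 + y ^+ 3 = z ^+ 3 /\ x * y * z != 0]].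
Proof.
move=> N; case: d1_def => _ [m def_d].
have : (0 < d1 * m ^ 2)%N by rewrite -def_d.
rewrite muln_gt0 expn_gt0 orbF => /andP [d1_gt0 m_gt0].
(* As 3 does not divide [d], [m ^ 2] is 1 modulo 3, so [d1] has the residue of [d]. *)
have d1_3 : (d1 %% 3 = 2)%N.
  have : (d %% 3 = 2)%N by move: d_mod3; clear; lia.
  rewrite def_d -modnMm -modnXm.
  by move: (ltn_pmod d1 (isT : 0 < 3)%N) (ltn_pmod m (isT : 0 < 3)%N);
     case: (d1 %% 3)%N => [|[|[|]]] //; case: (m %% 3)%N => [|[|[|]]].
(* The last term keeps the residue modulo [36 d1] and makes [D] exceed [N]. *)
pose w0 := (3 + 8 * d1 + 36 * d1 * N)%N.
have co3 : coprime 3 d1 by rewrite prime_coprime // /dvdn d1_3.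
(* [w0] is odd, 1 modulo 3, and 3 modulo [d1], which is prime to 3. *)
have co_w0 : coprime w0 (36 * d1).
  rewrite coprimeMr; apply/andP; split.
    rewrite (_ : 36 = (2 * 3) ^ 2)%N // coprimeXr // coprimeMr; apply/andP; split.
      rewrite coprimen2 (_ : w0 = (1 + 4 * d1 + 18 * d1 * N).*2.+1)%N ?oddS ?odd_double //.
      by rewrite -addn1 -muln2 /w0; ring.
    rewrite -coprime_modl (_ : w0 %% 3 = 1)%N // /w0.
    by move: d1_3; clear; lia.
  rewrite -coprime_modl (_ : w0 = (8 + 36 * N) * d1 + 3)%N; last by rewrite /w0; ring.
  by rewrite modnMDl coprime_modl.
have large p : prime p -> ~~ (p %| 36 * d1)%N ->
    (4 < p)%N && ~~ (p %| 16 * d1 ^ 3)%N.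
  move=> pp; rewrite Euclid_dvdM // negb_or => /andP [p36 pd1].
  have p4 : (4 < p)%N by case: p pp p36 {pd1} => [|[|[|[|[|]]]]].
  rewrite p4 Euclid_dvdM // Euclid_dvdX // (negPf pd1) orbF.
  by rewrite (_ : 16 = 2 ^ 4)%N // Euclid_dvdX // andbT gtnNdvd // (ltn_trans _ p4).
have M_gt0 : (0 < 36 * d1)%N by rewrite muln_gt0.
have c_gt0 : (0 < 16 * d1 ^ 3)%N by rewrite muln_gt0 expn_gt0 d1_gt0.
have w0_gt0 : (0 < w0)%N by [].
have [i [j sqf]] := squarefree_cube_form 1 M_gt0 c_gt0 w0_gt0 co_w0 large.
have [Q /= def_v] := cube_form_congruence N i j d1_3.
rewrite -/w0 in def_v; set w := (w0 + 36 * d1 * i)%N in sqf def_v.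
set z := (1 + 36 * d1 * j)%N in sqf def_v.
set D := (1 + 12 * d1 * Q)%N in def_v.
have ltND : (N.+1 < D)%N.
  (* 17 is [1 + 16], from [z >= 1] and [d1, w >= 1]. *)
  have : (w * 17 <= 3 * D)%N.
    rewrite -def_v leq_mul2l; apply/orP; right.
    apply: (@leq_add 1 16); first by rewrite expn_gt0.
    by rewrite -mulnA leq_pmulr // muln_gt0 !expn_gt0 d1_gt0.
  have : (36 * N + 3 <= w)%N.
    rewrite /w /w0; have := leq_mul (leqnn (36 * N)%N) d1_gt0; lia.
  lia.
have sqfD : squarefree D.
  apply: squarefree_prime_sqr => // p pp; apply/negP => p2D.
  (* Primes outside [36 d1] are handled by the sieve; the others divide [12 d1], hence not [D]. *)
  have [pM | pM] := boolP (p %| 36 * d1)%N; last first.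
    by case/negP: (sqf p pp pM); rewrite def_v dvdn_mull.
  have pD : (p %| D)%N by apply: dvdn_trans p2D; rewrite dvdn_exp.
  have p12 : (p %| 12 * d1)%N.
    move: pM; rewrite (_ : 36 = 3 * 12)%N // -mulnA Euclid_dvdM // => /orP [p3|//].
    by apply: dvdn_mulr; apply: dvdn_trans p3 _.
  by move: pD; rewrite /D (dvdn_addl _ (dvdn_mulr _ p12)) dvdn1 => /eqP p1; rewrite p1 in pp.
have D1 : (1 < D)%N by apply: leq_ltn_trans ltND.
have [L [s [t [s2 t2 full dim4]]]] := biquadratic_field d_gt0 sqfD D1.
exists D; split.
- exact: ltnW.
- left; split; last by rewrite absz_nat.
  by rewrite /D; move: (d1 * Q)%N (mulnA 12 d1 Q) => k <-; lia.
- by rewrite /D -modnDmr modnMr addn0.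
exists L; split=> //.
  by exists s, t; rewrite s2 t2 rmorphN.
(* With [u = 2 d1 w], [u (z ^ 3 + 2 u ^ 3)] is [2 d1] times the sieved value [3 D]. *)
apply: (@fermat_cubic_point L s t d d1 m D (2 * d1 * w) z) => //.
  by rewrite !muln_gt0 d1_gt0.
have -> : (6 * d1 * D = 2 * d1 * (3 * D))%N by ring.
by rewrite -def_v; ring.
Qed.
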